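(* Let $H$ be an invertible $n\times n$ real Hankel matrix and let $\mathbf{u}=(u_1,\ldots,u_{n+1})^T\in\mathbb{R}^{n+1}$ be a vector with $u_1\neq 0$ and $u_{n+1}\neq 0$; put $\mathbf{u}^J=(u_{n+1},u_n,\ldots,u_1)^T$. If $\mathbf{u}^J$ belongs to the kernel of $\partial H$, then for all integers $k\ge l$ and $s\ge t$ the extended matrix $\mathcal{H}[H:k,l;s,t]$ (formed with the companion matrices $C_t(\mathbf{u})$ and $C_r(\mathbf{u}^J)$) is Hankel.
   Context: For a vector $\mathbf{w}=(w_1,\ldots,w_{n+1})^T\in\mathbb{R}^{n+1}$ with $w_1,w_{n+1}\neq 0$, define the nonsingular $n\times n$ companion matrices: $C_t(\mathbf{w})$: first row $\left(-\frac{w_n}{w_{n+1}},-\frac{w_{n-1}}{w_{n+1}},\ldots,-\frac{w_1}{w_{n+1}}\right)$; rows $2,\ldots,n$ are $[\,I_{n-1}\;\;0\,]$. $C_r(\mathbf{w})$: columns $1,\ldots,n-1$ are $\begin{bmatrix}0\\ I_{n-1}\end{bmatrix}$; last column $\left(-\frac{w_1}{w_{n+1}},\ldots,-\frac{w_n}{w_{n+1}}\right)^T$. Write $C_t=C_t(\mathbf{u})$ and $\overline{C}_r=C_r(\mathbf{u}^J)$. For an $n\times n$ Hankel matrix $H$ with entries $H_{ij}=a_{i+j-n-1}$ (indices running from $1-n$ to $n-1$), $\partial H$ is the $(n-1)\times(n+1)$ Hankel matrix with entries $(\partial H)_{ij}=a_{i+j-n-1}$, $1\le i\le n-1$, $1\le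 j\le n+1$ (one column is added on the right preserving the Hankel structure and then the last row is deleted). Extensions: for an $n\times n$ matrix $A$ and integers $k\ge l$, $\mathcal{T}[A:k,l]$ is the $(n+k-l)\times n$ matrix $$\mathcal{T}[A:k,l]=\begin{bmatrix}\gamma_{k-l}\\ \vdots\\ \gamma_1\\ C_t^lA\end{bmatrix},$$ where $\gamma_i$ ($i=1,\ldots,k-l$) is the first row of $C_t^{l+i}A$. For integers $s\ge t$, the Hankel extension $\mathcal{H}[A:k,l;s,t]$ is the $(n+k-l)\times(n+s-t)$ matrix $$\mathcal{H}[A:k,l;s,t]=\begin{bmatrix}\mathcal{T}[A:k,l]\,\overline{C}_r^{\,t}&\beta_1&\cdots&\beta_{s-t}\end{bmatrix},$$ where $\beta_i$ ($i=1,\ldots,s-t$) is the last column of $\mathcal{T}[A:k,l]\,\overline{C}_r^{\,t+i}$. Here negative powers are powers of the inverse. A (possibly rectangular) matrix is Hankel if its $(i,j)$ entry depends only on $i+j$. *)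

(* Defs.v *)
From HB Require Import structures.
From mathcomp Require Import all_boot all_order all_algebra.

Set Implicit Arguments.
Unset Strict Implicit.
Unset Printing Implicit Defensive.

Import Order.TTheory GRing.Theory Num.Theory.
Local Open Scope ring_scope.

(* Square matrices have size n.+1 (size at least 1), so that 'M[F]_n.+1 is a
   unit ring and the integer powers C ^ z are available. All indices start
   at 0: w_1 and w_(n+1) in the usual 1-based notation are the entries of
   index ord0 and ord_max. The powers below have exponents in int. *)

Definition is_hankel (F : fieldType) (m n : nat) (A : 'M[F]_(m, n)) : Prop :=
  forall (i i' : 'I_m) (j j' : 'I_n), (i + j = i' + j')%N -> A i j = A i' j'.

Definition vflip (F : fieldType) (m : nat) (w : 'cV[F]_m) : 'cV[F]_m :=
  \col_(i < m) w (rev_ord i) 0.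

Definition companion_t (F : fieldType) (n : nat) (w : 'cV[F]_n.+2) :
    'M[F]_n.+1 :=
  \matrix_(i < n.+1, j < n.+1)
    if i == ord0
    then - (w (widen_ord (leqnSn n.+1) (rev_ord j)) 0 / w ord_max 0)
    else (i == j.+1 :> nat)%:R.

Definition companion_r (F : fieldType) (n : nat) (w : 'cV[F]_n.+2) :
    'M[F]_n.+1 :=
  \matrix_(i < n.+1, j < n.+1)
    if j == ord_max
    then - (w (widen_ord (leqnSn n.+1) i) 0 / w ord_max 0)
    else (i == j.+1 :> nat)%:R.

(* The operator written as a partial sign: for a Hankel matrix H, the column
   added on the right has i-th entry H (i + 1) n, which preserves the Hankel
   structure; its last entry is never needed since the last row is deleted. *)
Definition dhankel (F : fieldType) (n : nat) (H : 'M[F]_n.+1) :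
    'M[F]_(n, n.+2) :=
  \matrix_(i < n, j < n.+2)
    if unlift ord_max j is Some j'
    then H (widen_ord (leqnSn n) i) j'
    else H (lift ord0 i) ord_max.

Lemma dhankelE (F : fieldType) (n : nat) (H : 'M[F]_n.+1) (a : nat -> F) :
  (forall i j : 'I_n.+1, H i j = a (i + j)%N) ->
  forall (i : 'I_n) (j : 'I_n.+2), dhankel H i j = a (i + j)%N.
Proof.
move=> HE i j; rewrite mxE; case: unliftP => [j'|] ->; rewrite HE /=.
- by rewrite /bump leqNgt ltn_ord.
- by rewrite /bump leq0n addnS.
Qed.

(* The upper block is gamma_(k-l), ..., gamma_1 from top to bottom, where
   gamma_p is the first row of C_t ^ (l + p) *m A. The size `|k - l| is k - l
   because only l <= k is considered. *)
Definition row_ext (F : fieldType) (n : nat) (u : 'cV[F]_n.+2)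
    (A : 'M[F]_n.+1) (k l : int) : 'M[F]_(`|k - l|%N + n.+1, n.+1) :=
  col_mx
    (\matrix_(i < `|k - l|%N, j < n.+1)
       (companion_t u ^ (l + (`|k - l|%N - i)%N%:Z) *m A) ord0 j)
    (companion_t u ^ l *m A).

Definition hankel_ext (F : fieldType) (n : nat) (u : 'cV[F]_n.+2)
    (A : 'M[F]_n.+1) (k l s t : int) :
    'M[F]_(`|k - l|%N + n.+1, n.+1 + `|s - t|%N) :=
  row_mx
    (row_ext u A k l *m companion_r (vflip u) ^ t)
    (\matrix_(i < `|k - l|%N + n.+1, j < `|s - t|%N)
       (row_ext u A k l *m companion_r (vflip u) ^ (t + j.+1%:Z)) i ord_max).

(* Main.v *)
Require Import Defs.
From mathcomp Require Import all_boot all_order all_algebra.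
From mathcomp Require Import reals.
From mathcomp Require Import zify.

Import Order.TTheory GRing.Theory Num.Theory.
Local Open Scope ring_scope.

(** Read a Hankel matrix as a window on a scalar sequence [a], its entry (i, j)
    being [a (i + j)].  The kernel condition says that the sequence read off
    [H] obeys the linear recurrence with coefficients [vflip u].  For windows
    on such a sequence, multiplying by the companion matrix [companion_r] on
    the right slides the window one step forward, and multiplying by
    [companion_t] on the left slides it one step back.  Doing both changes
    nothing: [companion_t u *m H *m companion_r (vflip u) = H]
    ([companion_sandwich]).

    This identity carries everything else.  Since [H] is invertible, it forces
    both companion matrices to be invertible and gives
    [Ct ^ z *m H *m Cr ^ t = Ct ^ (z - t) *m H], so only the matrices
    [Ct ^ z *m H] matter.  Inside each of them, moving down one row or right one
    column amounts to lowering [z] by one ([companion_t_exprz_entry]); hence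
    all of them are windows on one two-sided sequence, indexed by [int].  The
    rows and columns added by the extension are further pieces of the same
    sequence, and the entry (i, j) of the extension is its term of index
    [i + j + t - k] ([hankel_ext_entry]). *)

Section CompanionShift.

Set Implicit Arguments.
Unset Strict Implicit.
Unset Printing Implicit Defensive.

Variables (F : fieldType) (n : nat).
Implicit Types (u w : 'cV[F]_n.+2) (a : nat -> F).

Lemma companion_t_lift u m (A : 'M[F]_(n.+1, m)) (i : 'I_n) j :
  (companion_t u *m A) (lift ord0 i) j = A (widen_ord (leqnSn n) i) j.
Proof.
rewrite mxE (bigD1 (widen_ord (leqnSn n) i)) //= big1 => [|k ne_ki].
  by rewrite mxE /= eqxx mul1r addr0.
rewrite mxE /= /bump /= add1n eqSS.
by rewrite eq_sym -val_eqE /= in ne_ki; rewrite (negbTE ne_ki) mul0r.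
Qed.

Lemma companion_r_widen w m (A : 'M[F]_(m, n.+1)) i (j : 'I_n) :
  (A *m companion_r w) i (widen_ord (leqnSn n) j) = A i (lift ord0 j).
Proof.
have lt_jn : (widen_ord (leqnSn n) j == ord_max) = false.
  by rewrite -val_eqE /= ltn_eqF.
rewrite mxE (bigD1 (lift ord0 j)) //= big1 => [|k ne_kj].
  by rewrite mxE lt_jn /= eqxx mulr1 addr0.
rewrite mxE lt_jn /=.
by rewrite -val_eqE /= /bump add1n in ne_kj; rewrite (negbTE ne_kj) mulr0.
Qed.

(** The vector [w] holds the coefficients of the recurrence, starting with the
    one of the oldest term. *)
Definition recurrent_at w a m := \sum_(j < n.+2) a (m + j)%N * w j 0 = 0.

(** The last column of [companion_r w] solves the recurrence for its newest
    term. *)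
Lemma mulmx_companion_r w a m (A : 'M[F]_(m, n.+1)) :
  w ord_max 0 != 0 -> (forall i : 'I_m, recurrent_at w a i) ->
  (forall i j, A i j = a (i + j)%N) ->
  forall i j, (A *m companion_r w) i j = a (i + j).+1.
Proof.
move=> w_neq0 rec_a AE i j; case: (unliftP ord_max j) => [j'|] ->.
  have -> : lift ord_max j' = widen_ord (leqnSn n) j'.
    by apply: val_inj; apply: lift_max.
  by rewrite companion_r_widen AE /= /bump add1n addnS.
have := rec_a i; rewrite /recurrent_at big_ord_recr /= addnS => rec_i.
apply: (mulIf w_neq0); rewrite -(addr0_eq rec_i).
rewrite mxE mulr_suml -sumrN; apply: eq_bigr => k _.
rewrite mxE eqxx AE mulrN mulNr -!mulrA mulVf // mulr1.
by congr (- (_ * w _ _)); apply: val_inj.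
Qed.

(** The first row of [companion_t u] solves the recurrence for its oldest
    term. *)
Lemma companion_t_mulmx u a m (A : 'M[F]_(n.+1, m)) :
  u ord_max 0 != 0 -> (forall j : 'I_m, recurrent_at (vflip u) a j) ->
  (forall i j, A i j = a (i + j).+1) ->
  forall i j, (companion_t u *m A) i j = a (i + j)%N.
Proof.
move=> u_neq0 rec_a AE i j; case: (unliftP ord0 i) => [i'|] ->.
  by rewrite companion_t_lift AE /= /bump add1n.
have := rec_a j; rewrite /recurrent_at big_ord_recl /= addn0 addrC => rec_j.
have w0E : vflip u ord0 0 = u ord_max 0.
  by rewrite mxE; congr (u _ _); apply: val_inj; rewrite /= subn1.
apply: (mulIf u_neq0); rewrite add0n -w0E -(addr0_eq rec_j) w0E.
rewrite mxE mulr_suml -sumrN; apply: eq_bigr => k _.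
rewrite mxE eqxx AE mulNr mulNr mulrAC mulfVK // mulrC addnC.
rewrite /= /bump /= add1n addnS [in RHS]mxE.
by congr (- (_ * u _ _)); apply: val_inj; rewrite /= /bump /= add1n; lia.
Qed.

(** The kernel condition gives the recurrence at the first [n] indices only, but
    a window of [n.+1] rows or columns also needs it at index [n].  That last
    instance can be taken as the definition of a term [a n.*2.+1], which lies
    outside [H]. *)
Lemma hankel_recurrent_seq (H : 'M[F]_n.+1) w :
  is_hankel H -> w ord_max 0 != 0 -> dhankel H *m w = 0 ->
  exists2 a, forall i j, H i j = a (i + j)%N &
             forall i : 'I_n.+1, recurrent_at w a i.
Proof.
move=> hankelH w_neq0 ker_w.
pose h m := H (inord (minn m n)) (inord (m - minn m n)).
pose c := - (\sum_(j < n.+1) h (n + j)%N * w (widen_ord (leqnSn n.+1) j) 0)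
          / w ord_max 0.
pose a m := if (m <= n.*2)%N then h m else c.
have HE i j : H i j = a (i + j)%N.
  have [lt_i lt_j] := (ltn_ord i, ltn_ord j).
  rewrite /a ifT; last by lia.
  by apply: hankelH; rewrite !inordK; lia.
exists a => // i; case: (unliftP ord_max i) => [i'|] ->.
  move/matrixP: ker_w => /(_ i' 0); rewrite !mxE /recurrent_at lift_max => ker_i.
  by rewrite -[RHS]ker_i; apply: eq_bigr => j _; rewrite (dhankelE HE).
rewrite /recurrent_at big_ord_recr /= {2}/a ifF; last by lia.
rewrite /c mulfVK //; apply/eqP; rewrite subr_eq0; apply/eqP.
apply: eq_bigr => j _; rewrite /a ifT //.
by have := ltn_ord j; lia.
Qed.

(** Slide the window forward with the right factor, then back with the left
    one. *)
Lemma companion_sandwich (H : 'M[F]_n.+1) u :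
  is_hankel H -> u ord0 0 != 0 -> u ord_max 0 != 0 ->
  dhankel H *m vflip u = 0 ->
  companion_t u *m H *m companion_r (vflip u) = H.
Proof.
move=> hankelH u0 uM ker_u.
have w_neq0 : vflip u ord_max 0 != 0.
  by rewrite mxE; congr (u _ _ != 0): u0; apply: val_inj; rewrite /= subnn.
have [a HE rec_a] := hankel_recurrent_seq hankelH w_neq0 ker_u.
apply/matrixP=> i j; rewrite -mulmxA HE.
exact/companion_t_mulmx/mulmx_companion_r.
Qed.

End CompanionShift.

Section TwoSidedSequence.

Set Implicit Arguments.
Unset Strict Implicit.
Unset Printing Implicit Defensive.

Variables (F : fieldType) (n : nat) (u : 'cV[F]_n.+2) (H : 'M[F]_n.+1).
Let Ct := companion_t u.
Let Cr := companion_r (vflip u).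
Hypotheses (H_unit : H \in unitmx) (sandwich : Ct *m H *m Cr = H).

Lemma companion_t_unit : Ct \in unitmx.
Proof. by move: H_unit; rewrite -sandwich !unitmx_mul -andbA => /and3P[]. Qed.

Lemma companion_r_unit : Cr \in unitmx.
Proof. by move: H_unit; rewrite -sandwich !unitmx_mul -andbA => /and3P[]. Qed.

Lemma companion_t_exprzS z : Ct ^ (z + 1) = Ct *m Ct ^ z.
Proof. by rewrite addrC exprzDr ?expr1z // companion_t_unit. Qed.

Lemma exprz_mulmx_companion_r z : Ct ^ (z + 1) *m H *m Cr = Ct ^ z *m H.
Proof.
by rewrite exprzDr ?companion_t_unit // expr1z -!mulmxE -!mulmxA [Ct *m _]mulmxA
  sandwich.
Qed.

Lemma exprz_mulmx_companion_r_exprz z t :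
  Ct ^ z *m H *m Cr ^ t = Ct ^ (z - t) *m H.
Proof.
elim/int_rec: t z => [z|m IHm z|m IHm z].
- by rewrite expr0z mulmx1 subr0.
- have -> : (m.+1 : int) = m%:Z + 1 by lia.
  rewrite (exprzDr companion_r_unit) expr1z -mulmxE mulmxA IHm.
  rewrite -[in RHS](exprz_mulmx_companion_r); congr (Ct ^ _ *m _ *m _); lia.
have -> : - (m.+1 : int) = - m%:Z - 1 by lia.
rewrite (exprzDr companion_r_unit) exprN1 -mulmxE mulmxA IHm.
apply: (canLR (mulmxK companion_r_unit)).
by rewrite -[LHS]exprz_mulmx_companion_r; congr (Ct ^ _ *m _ *m _); lia.
Qed.

(** The sign makes indices grow with rows and columns, since left multiplication
    by [Ct] slides a window back. *)
Definition two_sided (z : int) : F := (Ct ^ (- z) *m H) ord0 ord0.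

(** Moving an entry up one row peels a factor [Ct] off the left; moving it left
    one column adds a factor [Cr] on the right, which by [sandwich] also removes
    one factor [Ct].  Every entry thus reaches the top left corner at the cost
    of one unit of [z] per step, whence the inductions for all [z] at once. *)
Lemma companion_t_exprz_entry z (i j : 'I_n.+1) :
  (Ct ^ z *m H) i j = two_sided ((i + j)%N%:Z - z).
Proof.
case: i => i; elim: i z j => [|i IHi] z j lt_i.
  case: j => j; elim: j z => [|j IHj] z lt_j.
    have -> : Ordinal lt_i = ord0 by apply: val_inj.
    have -> : Ordinal lt_j = ord0 by apply: val_inj.
    by rewrite /two_sided; congr ((Ct ^ _ *m H) _ _); rewrite /=; lia.
  have -> : Ordinal lt_j = lift ord0 (Ordinal (lt_j : (j < n)%N)).
    exact: val_inj.
  rewrite -(companion_r_widen (vflip u)) -[in LHS](subrK 1 z).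
  rewrite exprz_mulmx_companion_r.
  have -> : widen_ord (leqnSn n) (Ordinal (lt_j : (j < n)%N)) = Ordinal (ltnW lt_j).
    exact: val_inj.
  by rewrite IHj; congr two_sided; rewrite /= /bump /=; lia.
have -> : Ordinal lt_i = lift ord0 (Ordinal (lt_i : (i < n)%N)).
  exact: val_inj.
rewrite -[in LHS](subrK 1 z) companion_t_exprzS -mulmxA companion_t_lift.
have -> : widen_ord (leqnSn n) (Ordinal (lt_i : (i < n)%N)) = Ordinal (ltnW lt_i).
  exact: val_inj.
by rewrite IHi; congr two_sided; rewrite /= /bump /=; lia.
Qed.

(** Each row of the row extension, old or new, is the first row of some
    [Ct ^ z *m H], and right multiplication by [Cr ^ t] acts row by row. *)
Lemma row_ext_mulmx_entry k l t i j : l <= k ->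
  (row_ext u H k l *m Cr ^ t) i j = two_sided ((i + j)%N%:Z + t - k).
Proof.
move=> le_lk; suff rowE : row i (row_ext u H k l) = row ord0 (Ct ^ (k - i%:Z) *m H).
  have -> : (row_ext u H k l *m Cr ^ t) i j = row i (row_ext u H k l *m Cr ^ t) 0 j.
    by rewrite [RHS]mxE.
  rewrite row_mul rowE -row_mul exprz_mulmx_companion_r_exprz mxE.
  by rewrite companion_t_exprz_entry; congr two_sided; rewrite /=; lia.
apply/rowP=> q; rewrite [LHS]mxE [RHS]mxE /row_ext mxE; case: splitP => i' iE.
  rewrite mxE; congr ((Ct ^ _ *m H) _ _).
  by have := ltn_ord i'; rewrite iE; lia.
rewrite !companion_t_exprz_entry iE; congr two_sided; rewrite /=; lia.
Qed.

Lemma hankel_ext_entry k l s t i j : l <= k ->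
  hankel_ext u H k l s t i j = two_sided ((i + j)%N%:Z + t - k).
Proof.
move=> le_lk; rewrite /hankel_ext mxE; case: splitP => j' jE.
  by rewrite row_ext_mulmx_entry // jE.
rewrite mxE row_ext_mulmx_entry // jE; congr two_sided; rewrite /=; lia.
Qed.

End TwoSidedSequence.

Theorem corollary2p11 (R : realType) (n : nat) (H : 'M[R]_n.+1)
    (u : 'cV[R]_n.+2)
    (H_hankel : is_hankel H) (H_unit : H \in unitmx)
    (u_first : u ord0 0 != 0) (u_last : u ord_max 0 != 0)
    (u_ker : dhankel H *m vflip u = 0)
    (k l s t : int) (le_lk : l <= k) (le_ts : t <= s) :
  is_hankel (hankel_ext u H k l s t).
Proof.
have sandwich := companion_sandwich H_hankel u_first u_last u_ker.
by move=> i i' j j' eq_ij; rewrite !hankel_ext_entry // eq_ij.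
Qed.
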